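(* Let $m\ge2$, $0<\rho<1$, and let $\mu$ be the self-similar measure associated with the IFS $$S_j(x)=\rho x+\frac{j}{m}(1-\rho),\qquad j=0,\dots,m,$$ and probabilities $p_0,\dots,p_m>0$, $\sum_{j=0}^m p_j=1$, that satisfy $p_0=p_m<\min_{j\neq0,m}p_j$. If $$\rho>\frac{\sqrt{m^2+4}-m}{2},$$ then the set of local dimensions of $\mu$ has an isolated point.
   Context: The self-similar measure associated with $(S_j,p_j)$ is the unique Borel probability measure $\mu$ satisfying $\mu=\sum_{j=0}^m p_j\cdot\mu\circ S_j^{-1}$. For $x\in\operatorname{supp}\mu$, the local dimension is $\dim_{\mathrm{loc}}\mu(x)=\lim_{\epsilon\to0^+}\frac{\log\mu([x-\epsilon,x+\epsilon])}{\log\epsilon}$ when the limit exists. The set of local dimensions of $\mu$ is the set of values $\dim_{\mathrm{loc}}\mu(x)$ over those $x\in\operatorname{supp}\mu$ where the limit exists. *)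

(* Defs.v *)
From HB Require Import structures.
From mathcomp Require Import all_boot all_order all_algebra.
From mathcomp Require Import all_classical all_reals all_analysis.
Set Implicit Arguments.
Unset Strict Implicit.
Unset Printing Implicit Defensive.
Import Order.TTheory GRing.Theory Num.Theory.
Import numFieldNormedType.Exports.
Local Open Scope classical_set_scope.
Local Open Scope ring_scope.

Definition ifs_map (R : realType) (m : nat) (rho : R) (j : 'I_m.+1) (x : R) : R :=
  rho * x + j%:R / m%:R * (1 - rho).

Definition self_similar_measure (R : realType) (n : nat) (S : 'I_n -> R -> R)
    (p : 'I_n -> R) (mu : probability (measurableTypeR R) R) : Prop :=
  forall A : set (measurableTypeR R), measurable A ->
    mu A = (\sum_(j < n) (p j)%:E * mu (S j @^-1` A))%E.

Definition support_measure (R : realType)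
    (mu : probability (measurableTypeR R) R) : set R :=
  [set x : R | forall U : set R, open U -> U x -> (0 < mu U)%E].

(* [fine] loses nothing as mu is finite, and the argument of the first
   logarithm is positive whenever x is in the support. *)
Definition has_local_dimension (R : realType)
    (mu : probability (measurableTypeR R) R) (x l : R) : Prop :=
  ln (fine (mu `[x - e, x + e]%classic)) / ln e @[e --> 0^'+] --> l.

Definition local_dimensions (R : realType)
    (mu : probability (measurableTypeR R) R) : set R :=
  [set l : R | exists2 x, support_measure mu x & has_local_dimension mu x l].

(* Main.v *)
(* At the fixed points 0 and 1 of the extreme maps the ball masses scale exactly
   by p_0, so both have local dimension L = ln p_0 / ln rho. Every other point x
   of the support lies in (0, 1). With c = (1 - rho) / m, the hypothesis on rho
   says c / rho < 1 - c: expanding a point near 0 by 1 / rho cannot jump from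
   below c to beyond 1 - c, so it lands where a middle letter is available. The
   middle letter can moreover be chosen so that its preimage of x stays at
   distance eta from 0 and 1. Hence x has a coding in which middle letters, of
   weight larger than p_0, recur with frequency bounded below, and its local
   dimension, if it exists, is at most L - a with a > 0 independent of x. *)
Require Import Defs.
From HB Require Import structures.
From mathcomp Require Import all_boot all_order all_algebra.
From mathcomp Require Import all_classical all_reals all_analysis.
From mathcomp Require Import ring lra.
Set Implicit Arguments.
Unset Strict Implicit.
Unset Printing Implicit Defensive.
Import Order.TTheory GRing.Theory Num.Theory.
Import numFieldNormedType.Exports.
Local Open Scope classical_set_scope.
Local Open Scope ring_scope.

(** * Masses of closed intervals *)

Definition mass (R : realType) (mu : probability (measurableTypeR R) R)
    (a b : R) : R := fine (mu `[a, b]%classic).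

Lemma mass_fin_num (R : realType) (mu : probability (measurableTypeR R) R)
    (a b : R) : mu `[a, b]%classic \is a fin_num.
Proof. by apply: fin_num_measure; exact: measurable_itv. Qed.

Lemma mass_ge0 (R : realType) (mu : probability (measurableTypeR R) R)
    (a b : R) : 0 <= mass mu a b.
Proof. exact/fine_ge0/measure_ge0. Qed.

Lemma mass_le1 (R : realType) (mu : probability (measurableTypeR R) R)
    (a b : R) : mass mu a b <= 1.
Proof.
rewrite -lee_fin /mass fineK ?mass_fin_num//.
by apply: probability_le1; exact: measurable_itv.
Qed.

Lemma mass_mono (R : realType) (mu : probability (measurableTypeR R) R)
    (a b a' b' : R) : a' <= a -> b <= b' -> mass mu a b <= mass mu a' b'.
Proof.
move=> aa bb; rewrite /mass fine_le ?mass_fin_num//.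
apply: le_measure; rewrite ?inE; try exact: measurable_itv.
by apply: subset_itvScc; rewrite bnd_simp.
Qed.

Lemma mass_disjoint (R : realType) (mu : probability (measurableTypeR R) R)
    (a b a' b' : R) : b < a' -> mass mu a b + mass mu a' b' <= 1.
Proof.
move=> ba; rewrite -lee_fin EFinD /mass !fineK ?mass_fin_num//.
rewrite -measureU; try exact: measurable_itv; last first.
  apply/seteqP; split => // x /= []; rewrite !in_itv /= => /andP[_ h] /andP[h' _].
  by have := le_lt_trans h ba; rewrite ltNge h'.
by apply: probability_le1; apply: measurableU; exact: measurable_itv.
Qed.

Lemma mass_cvg (R : realType) (mu : probability (measurableTypeR R) R) :
  mass mu (- n%:R) n%:R @[n --> \oo] --> (1 : R).
Proof.
suff /fine_cvgP[] : mu `[- n%:R, n%:R]%classic @[n --> \oo] --> (1%:E : \bar R).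
  by [].
rewrite -(probability_setT mu) -(bigcup_itvT true false).
apply: nondecreasing_cvg_mu.
- by move=> n; exact: measurable_itv.
- by rewrite bigcup_itvT; exact: measurableT.
- by move=> n k nk; apply/subsetPset/subset_itvScc; rewrite bnd_simp ?lerN2 ler_nat.
Qed.

(** * Self-similarity of the interval masses *)

Lemma mass_ifs (R : realType) (m : nat) (rho : R) (p : 'I_m.+1 -> R)
    (mu : probability (measurableTypeR R) R) (rho0 : 0 < rho)
    (hmu : self_similar_measure (@ifs_map R m rho) p mu) (a b : R) :
  let c := (1 - rho) / m%:R in
  mass mu a b =
  \sum_(j < m.+1) p j * mass mu ((a - j%:R * c) / rho) ((b - j%:R * c) / rho).
Proof.
move=> c; rewrite /mass hmu; last exact: measurable_itv.
have pre (j : 'I_m.+1) : @ifs_map R m rho j @^-1` `[a, b]%classic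
    = `[(a - j%:R * c) / rho, (b - j%:R * c) / rho]%classic.
  apply/seteqP; split => x /=; rewrite !in_itv /= /ifs_map;
  by rewrite ler_pdivrMr// ler_pdivlMr// lerBlDr lerBrDr (mulrC x) /c mulrA mulrAC.
rewrite -sum_fine; last first.
  by move=> j _; rewrite pre fin_numM// mass_fin_num.
by apply: eq_bigr => j _; rewrite pre fineM ?mass_fin_num.
Qed.

(** The translation part of each map lies in [[0, 1 - rho]], so the preimage of [[-s, 1 + s]]
    contains [[-s / rho, 1 + s / rho]]. Iterating from [s = t] bounds the mass below by that of
    intervals exhausting the line; the positive margin is what grows. *)
Lemma mass_unit_interval (R : realType) (m : nat) (rho : R)
    (p : 'I_m.+1 -> R) (mu : probability (measurableTypeR R) R)
    (hm : (0 < m)%N) (hrho : 0 < rho < 1) (hp_pos : forall j, 0 < p j)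
    (hp_sum : \sum_(j < m.+1) p j = 1)
    (hmu : self_similar_measure (@ifs_map R m rho) p mu) (t : R) :
  0 < t -> mass mu (- t) (1 + t) = 1.
Proof.
case/andP: hrho => r0 r1 t0.
have m0 : 0 < m%:R :> R by rewrite ltr0n.
have expand s : mass mu (- (s / rho)) (1 + s / rho) <= mass mu (- s) (1 + s).
  rewrite (mass_ifs r0 hmu (- s)) /=.
  rewrite -[leLHS]mul1r -[X in X * _ <= _]hp_sum mulr_suml ler_sum// => j _.
  rewrite ler_pM2l//; set d := j%:R * _.
  have d0 : 0 <= d by rewrite mulr_ge0// divr_ge0 ?subr_ge0 ?ltW.
  have d1 : d <= 1 - rho.
    rewrite /d mulrCA -[leRHS]mulr1 ler_pM2l ?subr_gt0//.
    by rewrite ler_pdivrMr// mul1r ler_nat -ltnS.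
  apply: mass_mono.
    by rewrite ler_pdivrMr// mulNr divfK ?gt_eqF//; lra.
  by rewrite ler_pdivlMr// mulrDl divfK ?gt_eqF//; lra.
have iterE n : mass mu (- (t / rho ^+ n)) (1 + t / rho ^+ n) <= mass mu (- t) (1 + t).
  elim: n => [|n IH]; first by rewrite expr0 divr1.
  apply: le_trans IH; rewrite exprSr invfM mulrA; exact: expand.
apply/eqP; rewrite eq_le mass_le1/=.
apply: (cvgr_to_le (mass_cvg mu)).
near=> k.
have [n hn] : exists n, k%:R <= t / rho ^+ n.
  have : rho ^+ n @[n --> \oo] --> 0 by apply: cvg_expr; rewrite ger0_norm ?ltW.
  have e0 : 0 < t / k.+1%:R by rewrite divr_gt0.
  move=> /cvgrPdist_lt /(_ _ e0) [N _ /(_ N (leqnn N))] /=.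
  rewrite sub0r normrN ger0_norm ?exprn_ge0 ?ltW// ltr_pdivlMr// => h.
  exists N; rewrite ler_pdivlMr ?exprn_gt0//.
  apply: le_trans (ltW h); rewrite mulrC ler_pM2l ?exprn_gt0//.
  by rewrite ler_nat.
apply: le_trans (iterE n); apply: mass_mono; first by rewrite lerN2.
by lra.
Unshelve. all: by end_near.
Qed.

(** Only the [j]-th term of the self-similar sum is kept: the preimage of the ball about [x] is the
    ball about [y]. *)
Lemma mass_ball_ifs (R : realType) (m : nat) (rho : R) (p : 'I_m.+1 -> R)
    (mu : probability (measurableTypeR R) R) (rho0 : 0 < rho)
    (hp_pos : forall j, 0 < p j)
    (hmu : self_similar_measure (@ifs_map R m rho) p mu)
    (j : 'I_m.+1) (x y e : R) :
  x = rho * y + j%:R * ((1 - rho) / m%:R) ->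
  p j * mass mu (y - e) (y + e) <= mass mu (x - rho * e) (x + rho * e).
Proof.
move=> xE; rewrite (mass_ifs rho0 hmu (x - _)) /= (bigD1 j)//=.
have -> : (x - rho * e - j%:R * ((1 - rho) / m%:R)) / rho = y - e.
  by rewrite xE; set d := j%:R * _; field; rewrite gt_eqF.
have -> : (x + rho * e - j%:R * ((1 - rho) / m%:R)) / rho = y + e.
  by rewrite xE; set d := j%:R * _; field; rewrite gt_eqF.
rewrite lerDl sumr_ge0// => i _; rewrite mulr_ge0 ?mass_ge0//; exact: ltW.
Qed.

(** * Limits of logarithmic ratios *)

(** The difference [h e = ln (g e) - L * ln e] is invariant under [e -> rho * e], so a bound on the
    fundamental domain []rho * t, t]] holds on all of []0, t]]. Dividing by [ln e], which tends to
    minus infinity, leaves [L]. *)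
Lemma ln_ratio_cvg_self_similar (R : realType) (g : R -> R) (rho q t : R) :
  0 < rho < 1 -> 0 < q -> 0 < t -> 0 < g t ->
  (forall e, g e <= 1) -> (forall a b, a <= b -> g a <= g b) ->
  (forall e, 0 < e <= t -> g (rho * e) = q * g e) ->
  ln (g e) / ln e @[e --> 0^'+] --> ln q / ln rho.
Proof.
move=> /andP[r0 r1] q0 t0 gt0 g1 gmono gE.
have lr0 : ln rho < 0 by rewrite ln_lt0// r0.
set L := ln q / ln rho.
pose h e := ln (g e) - L * ln e.
(* On the fundamental domain monotonicity puts [g e] between [g (rho * t) = q * g t] and 1; [M]
   collects the resulting bounds on both terms of [h]. *)
pose M := `|ln (q * g t)| + `|L| * (`|ln (rho * t)| + `|ln t|).
have rt0 : 0 < rho * t by rewrite mulr_gt0.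
have base e : rho * t < e -> e <= t -> 0 < g e /\ `|h e| <= M.
  move=> e1 e2.
  have e0 : 0 < e by exact: lt_trans e1.
  have ge : q * g t <= g e by rewrite -gE ?t0 ?lexx// gmono// ltW.
  have qg0 : 0 < q * g t by rewrite mulr_gt0.
  have ge0 : 0 < g e by exact: lt_le_trans ge.
  split => //; rewrite /h (le_trans (ler_normB _ _))//.
  have H1 : ln (q * g t) <= ln (g e) by rewrite ler_ln ?posrE.
  have H2 : ln (g e) <= 0 by exact/ln_le0.
  have H3 : ln (rho * t) <= ln e by rewrite ler_ln ?posrE// ltW.
  have H4 : ln e <= ln t by rewrite ler_ln ?posrE.
  rewrite normrM lerD// ?ler_wpM2l//.
    by rewrite !ler0_norm ?lerN2//; exact: le_trans H2.
  by rewrite ler_norml; have := normr_ge0 (ln (rho * t));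
    have := normr_ge0 (ln t); have := ler_norm (ln t);
    have := ler_norm (- ln (rho * t)); rewrite normrN => *; apply/andP; split; lra.
have step n e : rho ^+ n * t < e -> e <= t -> 0 < g e /\ `|h e| <= M.
  elim: n e => [|n IH] e e1 e2.
    by move: e1; rewrite expr0 mul1r ltNge e2.
  have [|le] := ltP (rho * t) e; first by move=> e3; exact: base.
  have e0 : 0 < e by apply: lt_trans e1; rewrite mulr_gt0 ?exprn_gt0.
  have eE : e = rho * (e / rho) by rewrite mulrC divfK ?gt_eqF.
  have e3 : e / rho <= t by rewrite ler_pdivrMr// mulrC.
  have [] := IH (e / rho) _ e3.
    by rewrite ltr_pdivlMr// mulrAC -exprSr.
  move=> g0 hM.
  have e'0 : 0 < e / rho by rewrite divr_gt0.
  have gE' : g e = q * g (e / rho) by rewrite -gE ?e'0// -eE.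
  split; first by rewrite gE' mulr_gt0.
  suff -> : h e = h (e / rho) by [].
  have lnE : ln e = ln rho + ln (e / rho) by rewrite -lnM ?posrE// -eE.
  rewrite /h gE' lnE lnM ?posrE// /L; field; exact: ltr0_neq0.
have bnd e : 0 < e -> e <= t -> `|h e| <= M.
  move=> e0 et.
  have : rho ^+ n @[n --> \oo] --> 0 by apply: cvg_expr; rewrite ger0_norm ?ltW.
  have e1 : 0 < e / t by rewrite divr_gt0.
  move=> /cvgrPdist_lt /(_ _ e1) [N _ /(_ N (leqnn N))] /=.
  have rN : 0 <= rho ^+ N by rewrite exprn_ge0// ltW.
  rewrite sub0r normrN ger0_norm// ltr_pdivlMr// => lt.
  by have [] := step _ _ lt et.
have inv0 : (ln e)^-1 @[e --> 0^'+] --> (0 : R).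
  apply/ltr0_cvgV0; last exact: lnNy.
  near=> e; rewrite ln_lt0//; apply/andP; split.
    by near: e; exact: nbhs_right_gt.
  by near: e; exact: nbhs_right_lt.
apply/cvgrPdist_le => eps eps0.
have /cvgrPdist_lt : (ln e)^-1 @[e --> 0^'+] --> (0 : R) by exact: inv0.
(* [M] is only known to be nonnegative, hence the divisor [M + 1]. *)
have M1 : 0 < M + 1 by rewrite ltr_wpDl// addr_ge0// mulr_ge0// addr_ge0.
have d0 : 0 < eps / (M + 1) by rewrite divr_gt0.
move=> /(_ _ d0) H.
near=> e.
have e0 : 0 < e by near: e; exact: nbhs_right_gt.
have et : e <= t by near: e; exact: nbhs_right_le.
have e1 : e < 1 by near: e; exact: nbhs_right_lt.
have He : `|0 - (ln e)^-1| < eps / (M + 1) by near: e.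
have le0 : ln e < 0 by rewrite ln_lt0// e0.
have -> : L - ln (g e) / ln e = - (h e * (ln e)^-1).
  by rewrite /h; field; exact: ltr0_neq0.
rewrite normrN normrM.
move: He; rewrite sub0r normrN => /ltW He.
apply: (le_trans (ler_pM _ _ (bnd e e0 et) He)) => //.
rewrite mulrCA ger_pMr// ler_pdivrMr//; lra.
Unshelve. all: by end_near.
Qed.

(** Since the limit is assumed to exist, the radii [rho ^+ n] suffice. The constant contributes
    [ln C / (n * ln rho)], which vanishes in the limit, and the negative sign of [ln rho] turns the
    lower bound on [g] into an upper bound on the ratio. Exponents start at 1 so that the
    denominator is nonzero. *)
Lemma ln_ratio_lim_le (R : realType) (g : R -> R) (rho q C l : R) :
  0 < rho < 1 -> 0 < q -> 0 < C ->
  (forall n, C * q ^+ n <= g (rho ^+ n)) ->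
  ln (g e) / ln e @[e --> 0^'+] --> l -> l <= ln q / ln rho.
Proof.
move=> /andP[r0 r1] q0 C0 gC /cvg_at_rightP glim.
have lr0 : ln rho < 0 by rewrite ln_lt0// r0.
have lim : ln (g (rho ^+ n.+1)) / ln (rho ^+ n.+1) @[n --> \oo] --> l.
  apply: (glim (fun n => rho ^+ n.+1)); split; first by move=> n; rewrite exprn_gt0.
  rewrite (cvg_shiftS (fun n => rho ^+ n)).
  by apply: cvg_expr; rewrite ger0_norm ?ltW.
have ub : ln q / ln rho + ln C / ln rho * n.+1%:R^-1 @[n --> \oo] --> ln q / ln rho.
  rewrite -[X in _ --> X]addr0; apply: cvgD; first exact: cvg_cst.
  rewrite -[X in _ --> X](mulr0 (ln C / ln rho)); apply: cvgMr.
  exact: cvg_harmonic.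
apply: (ler_cvg_to lim ub); near=> n.
have Cq : 0 < C * q ^+ n.+1 by rewrite mulr_gt0 ?exprn_gt0.
have : ln (C * q ^+ n.+1) <= ln (g (rho ^+ n.+1)).
  by rewrite ler_ln ?posrE//; exact: lt_le_trans (gC _).
rewrite lnM ?posrE ?exprn_gt0// !lnXn// => H.
have n0 : ln rho *+ n.+1 < 0 by rewrite pmulrn_llt0.
have -> : ln q / ln rho + ln C / ln rho * n.+1%:R^-1
  = (ln C + ln q *+ n.+1) / (ln rho *+ n.+1).
  have : n.+1%:R != 0 :> R by rewrite pnatr_eq0.
  rewrite -(mulr_natr (ln q)) -(mulr_natr (ln rho)).
  by move: (n.+1%:R : R) => N N0; field; rewrite N0 ltr0_neq0.
by rewrite ler_nM2r// invr_lt0.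
Unshelve. all: by end_near.
Qed.

(** * Lower bound for the mass around interior points *)

(** A potential for the coding: expanding away from an end multiplies it by at least [1 / rho]. The
    value 1 in the middle, in place of the distance to the nearer end, keeps this true when the
    expansion jumps past [1 / 2]. *)
Definition end_distance (R : realType) (b x : R) : R :=
  if x < b then x else if 1 - b < x then 1 - x else 1.

Lemma end_distance_gt0 (R : realType) (b x : R) :
  0 < x < 1 -> 0 < end_distance b x.
Proof. by rewrite /end_distance; case: ifP => _; [|case: ifP => _]; lra. Qed.

Lemma end_distance_le1 (R : realType) (b x : R) :
  0 < x < 1 -> end_distance b x <= 1.
Proof. by rewrite /end_distance; case: ifP => _; [|case: ifP => _]; lra. Qed.

Lemma end_distance_powR_le1 (R : realType) (a b x : R) :
  0 <= a -> 0 < x < 1 -> end_distance b x `^ a <= 1.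
Proof.
move=> a0 x01; have -> : 1 = 1 `^ a by rewrite powR1.
by rewrite ge0_ler_powR ?nnegrE ?ler01 ?end_distance_le1// ltW ?end_distance_gt0.
Qed.

(** The intervals [[i * c + rho * eta, i * c + rho * (1 - eta)]] have length at least the spacing
    [c], so those with [1 <= i <= k.+1] cover the range of [x] without gaps. *)
Lemma middle_letter (R : realType) (rho c eta x : R) (k : nat) :
  c <= rho * (1 - 2 * eta) -> c + eta * rho <= x ->
  x <= k.+1%:R * c + rho * (1 - eta) ->
  exists2 j : nat, (j <= k)%N &
    rho * eta <= x - j.+1%:R * c <= rho * (1 - eta).
Proof.
move=> H2 xl; elim: k => [|k IH] xu.
  by exists 0%N => //; move: xu; rewrite mul1r => xu; lra.
have [h|h] := leP x (k.+1%:R * c + rho * (1 - eta)).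
  by have [j jk hj] := IH h; exists j => //; exact: leqW.
by exists k.+1 => //; move: xu h; rewrite -[k.+2%:R]natr1 => xu h; lra.
Qed.

(* Words following this choice of letters cannot stay near an end forever:
   on [b, 1 - b] a middle letter of larger weight is used, and
   [b <= rho * (1 - b)] makes an orbit leaving an end interval land there. The
   factor [rho `^ a < 1] is the gain, spread evenly over all the steps. *)
Lemma good_letter (R : realType) (m : nat) (rho c eta a : R)
    (p : 'I_m.+1 -> R) (x : R) :
  let b := c + eta * rho in
  (2 <= m)%N -> 0 < rho < 1 -> 0 < c -> m%:R * c = 1 - rho -> 0 < eta ->
  b <= rho * (1 - b) -> c <= rho * (1 - 2 * eta) -> 0 < a ->
  0 < p ord0 -> p ord0 = p ord_max ->
  (forall j, j != ord0 -> j != ord_max ->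
     p ord0 <= p j * (eta * rho) `^ a) ->
  0 < x < 1 ->
  exists (j : 'I_m.+1) (y : R), [/\ x = rho * y + j%:R * c, 0 < y < 1 &
    p ord0 / rho `^ a * end_distance b x `^ a <= p j * end_distance b y `^ a].
Proof.
move=> b m2 /andP[r0 r1] c0 mc e0 H1 H2 a0 p0 pE hp /andP[x0 x1].
have b0 : 0 < b by rewrite addr_gt0// mulr_gt0.
have ra0 : 0 < rho `^ a by exact: powR_gt0.
have endP (y : R) : 0 < y < 1 -> end_distance b x <= rho * end_distance b y ->
    p ord0 / rho `^ a * end_distance b x `^ a <= p ord0 * end_distance b y `^ a.
  move=> y01 dxy.
  have dx := @end_distance_gt0 R b x; have dy := @end_distance_gt0 R b y.
  have dx0 : 0 < end_distance b x by apply: dx; rewrite x0.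
  have dy0 : 0 < end_distance b y by exact: dy.
  rewrite -mulrA ler_pM2l// mulrC ler_pdivrMr// mulrC.
  rewrite -powRM; [|exact: ltW|exact: ltW].
  by rewrite ge0_ler_powR// ?nnegrE ?ltW// mulr_gt0.
have bb : b < 1 - b.
  have : rho * (1 - b) < 1 - b by rewrite gtr_pMl//; nra.
  lra.
have [xb|xb] := ltP x b.
  exists ord0, (x / rho).
  have y01 : 0 < x / rho < 1.
    rewrite divr_gt0//= ltr_pdivrMr//; nra.
  have yb : x / rho < 1 - b by rewrite ltr_pdivrMr//; lra.
  split => //; first by rewrite mul0r addr0 mulrC divfK ?gt_eqF.
  apply: endP => //; rewrite {1}/end_distance xb -ler_pdivrMl// mulrC.
  rewrite /end_distance; case: ifP => // _; case: ifP => h; lra.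
have [xb'|xb'] := ltP (1 - b) x.
  exists ord_max, (1 - (1 - x) / rho).
  have y01 : 0 < 1 - (1 - x) / rho < 1.
    apply/andP; split; last by rewrite gtrBl divr_gt0// subr_gt0.
    rewrite subr_gt0 ltr_pdivrMr//; nra.
  have yb : (1 - x) / rho < 1 - b by rewrite ltr_pdivrMr//; lra.
  split => //.
    by rewrite /= mc mulrBr [rho * (_ / _)]mulrC divfK ?gt_eqF//; lra.
  rewrite -pE; apply: endP => //.
  rewrite {1}/end_distance ltNge xb /= xb' -ler_pdivrMl// mulrC.
  rewrite /end_distance; case: ifP => h; last by case: ifP => h'; lra.
  by move: y01; lra.
have [k km] : exists k, m = k.+2.
  by exists (m - 2)%N; rewrite -addn2 subnK.
(* The right-hand side equals [1 - b], because [k.+2%:R * c = 1 - rho]. *)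
have xu : x <= k.+1%:R * c + rho * (1 - eta).
  move: mc; rewrite km -natr1 mulrDl mul1r => mc.
  by apply: (le_trans xb'); rewrite /b; lra.
have [j jk /andP[jl ju]] := middle_letter H2 xb xu.
have jm : (j.+1 < m.+1)%N by rewrite km !ltnS leqW.
pose i : 'I_m.+1 := Ordinal jm.
exists i, ((x - j.+1%:R * c) / rho).
set y := _ / rho.
have yl : eta <= y by rewrite ler_pdivlMr// [eta * _]mulrC.
have yu : y <= 1 - eta by rewrite ler_pdivrMr// [_ * rho]mulrC.
have y01 : 0 < y < 1 by lra.
split => //; first by rewrite /y mulrC divfK ?gt_eqF//= subrK.
have i0 : i != ord0 by [].
have im : i != ord_max by rewrite -val_eqE /= km eqSS ltn_eqF// ltnS.
have dx1 : end_distance b x `^ a <= 1.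
  by apply: end_distance_powR_le1; rewrite ?x0// ltW.
have dy : eta <= end_distance b y.
  rewrite /end_distance; case: ifP => // _; case: ifP => // _; lra.
(* The surplus weight of a middle letter pays twice: [rho]^ a[for the gain of this step, and]eta
   [^ a] for the drop of the potential from at most 1 to no less than [eta]. *)
have pi := hp i i0 im.
have pi0 : 0 < p i.
  by have := lt_le_trans p0 pi; rewrite pmulr_lgt0 ?powR_gt0 ?mulr_gt0.
apply: (@le_trans _ _ (p ord0 / rho `^ a)).
  by rewrite ler_piMr// divr_ge0 ?ltW.
rewrite ler_pdivrMr//; apply: (le_trans pi).
rewrite -mulrA ler_pM2l// -powRM ?(ltW r0) ?(ltW (end_distance_gt0 _ y01))//.
by rewrite ge0_ler_powR ?ler_pM2r// ?nnegrE ltW// mulr_gt0// end_distance_gt0.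
Qed.

Lemma mass_interior_ge (R : realType) (m : nat) (rho eta a : R)
    (p : 'I_m.+1 -> R) (mu : probability (measurableTypeR R) R) (x : R) (n : nat) :
  let c := (1 - rho) / m%:R in
  let b := c + eta * rho in
  (2 <= m)%N -> 0 < rho < 1 -> 0 < eta ->
  b <= rho * (1 - b) -> c <= rho * (1 - 2 * eta) -> 0 < a ->
  (forall j, 0 < p j) -> \sum_(j < m.+1) p j = 1 -> p ord0 = p ord_max ->
  (forall j, j != ord0 -> j != ord_max ->
     p ord0 <= p j * (eta * rho) `^ a) ->
  self_similar_measure (@ifs_map R m rho) p mu ->
  0 < x < 1 ->
  end_distance b x `^ a * (p ord0 / rho `^ a) ^+ n
    <= mass mu (x - rho ^+ n) (x + rho ^+ n).
Proof.
move=> c b m2 r01 e0 H1 H2 a0 p0 psum pE hp hmu.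
have /andP[r0 r1] := r01.
have m0 : 0 < m%:R :> R by rewrite ltr0n (leq_trans _ m2).
have c0 : 0 < c by rewrite divr_gt0 ?subr_gt0.
have mc : m%:R * c = 1 - rho by rewrite mulrC divfK ?gt_eqF.
elim: n x => [|n IH] x x01.
  (* With this margin [t], the ball of radius 1 about [x] contains [[-t, 1 + t]] and so has full
     mass. *)
  have t0 : 0 < Num.min x (1 - x) by rewrite lt_min; lra.
  have t1 : Num.min x (1 - x) <= x by rewrite ge_min lexx.
  have t2 : Num.min x (1 - x) <= 1 - x by rewrite ge_min lexx orbT.
  apply: (@le_trans _ _ 1).
    by rewrite expr0 mulr1; apply: end_distance_powR_le1 => //; exact: ltW.
  rewrite -(mass_unit_interval (ltnW m2) r01 p0 psum hmu t0).
  by apply: mass_mono; lra.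
have [j [y [xE y01 hj]]] :=
  good_letter m2 r01 c0 mc e0 H1 H2 a0 (p0 ord0) pE hp x01.
have := mass_ball_ifs r0 p0 hmu (rho ^+ n) xE; rewrite -exprS; apply: le_trans.
rewrite exprS mulrA [_ * (p ord0 / _)]mulrC.
have q0 : 0 <= (p ord0 / rho `^ a) ^+ n.
  by rewrite exprn_ge0// divr_ge0 ?powR_ge0 ?ltW.
apply: (le_trans (ler_wpM2r q0 hj)).
by rewrite -mulrA ler_pM2l// IH.
Qed.

(** * Support and local dimensions *)

Lemma mass_outside (R : realType) (m : nat) (rho : R)
    (p : 'I_m.+1 -> R) (mu : probability (measurableTypeR R) R)
    (hm : (0 < m)%N) (hrho : 0 < rho < 1) (hp_pos : forall j, 0 < p j)
    (hp_sum : \sum_(j < m.+1) p j = 1)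
    (hmu : self_similar_measure (@ifs_map R m rho) p mu) (a b : R) :
  b < 0 \/ 1 < a -> mass mu a b = 0.
Proof.
move=> ab; apply/eqP; rewrite eq_le mass_ge0 andbT.
case: ab => [b0|a1].
  have t0 : 0 < - b / 2 by rewrite divr_gt0// oppr_gt0.
  have bt : b < - (- b / 2) by lra.
  have := mass_disjoint mu a (1 + - b / 2) bt.
  by rewrite (mass_unit_interval hm hrho hp_pos hp_sum hmu t0); lra.
have t0 : 0 < (a - 1) / 2 by rewrite divr_gt0// subr_gt0.
have at1 : 1 + (a - 1) / 2 < a by lra.
have := mass_disjoint mu (- ((a - 1) / 2)) b at1.
by rewrite (mass_unit_interval hm hrho hp_pos hp_sum hmu t0); lra.
Qed.

Lemma support_unit_interval (R : realType) (m : nat) (rho : R)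
    (p : 'I_m.+1 -> R) (mu : probability (measurableTypeR R) R)
    (hm : (0 < m)%N) (hrho : 0 < rho < 1) (hp_pos : forall j, 0 < p j)
    (hp_sum : \sum_(j < m.+1) p j = 1)
    (hmu : self_similar_measure (@ifs_map R m rho) p mu) (x : R) :
  support_measure mu x -> 0 <= x <= 1.
Proof.
move=> sx.
have ball0 e : 0 < e -> mass mu (x - e) (x + e) != 0.
  move=> e0; have := sx `]x - e, x + e[%classic (itv_open _ _) _.
  rewrite /= in_itv /= => /(_ _)/lt_le_trans h.
  have : (0 < mu `[(x - e)%R, (x + e)%R]%classic)%E.
    apply: h; first by apply/andP; split; lra.
    apply: le_measure; rewrite ?inE; try exact: measurable_itv.
    exact: subset_itvW.
  move=> h'; rewrite gt_eqF// -lte_fin /mass fineK ?mass_fin_num//.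
rewrite leNgt [x <= 1]leNgt -negb_or; apply/negP => /orP[x0|x1].
  have e0 : 0 < - x / 2 by rewrite divr_gt0// oppr_gt0.
  move/eqP: (ball0 _ e0); apply.
  by apply: (mass_outside hm hrho hp_pos hp_sum hmu); left; lra.
have e0 : 0 < (x - 1) / 2 by rewrite divr_gt0// subr_gt0.
move/eqP: (ball0 _ e0); apply.
by apply: (mass_outside hm hrho hp_pos hp_sum hmu); right; lra.
Qed.

(** Repeating the letter [j] that fixes [z] shrinks balls about [z] by [rho] at the cost of [p j].
    The radius starts at 2 because that ball contains [[-1, 2]], which has full mass. *)
Lemma mass_fixpoint_gt0 (R : realType) (m : nat) (rho : R)
    (p : 'I_m.+1 -> R) (mu : probability (measurableTypeR R) R)
    (hm : (0 < m)%N) (hrho : 0 < rho < 1) (hp_pos : forall j, 0 < p j)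
    (hp_sum : \sum_(j < m.+1) p j = 1)
    (hmu : self_similar_measure (@ifs_map R m rho) p mu)
    (j : 'I_m.+1) (z e : R) :
  0 <= z <= 1 -> z = rho * z + j%:R * ((1 - rho) / m%:R) -> 0 < e ->
  0 < mass mu (z - e) (z + e).
Proof.
move=> z01 zE e0; have /andP[r0 r1] := hrho.
have low n : p j ^+ n <= mass mu (z - rho ^+ n * 2) (z + rho ^+ n * 2).
  elim: n => [|n IH].
    rewrite !expr0 mul1r -[leLHS](mass_unit_interval hm hrho hp_pos hp_sum hmu ltr01).
    by apply: mass_mono; lra.
  rewrite !exprS -mulrA; have := mass_ball_ifs r0 hp_pos hmu (rho ^+ n * 2) zE.
  by apply: le_trans; rewrite ler_pM2l.
have : rho ^+ n @[n --> \oo] --> 0 by apply: cvg_expr; rewrite ger0_norm// ltW.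
have e2 : 0 < e / 2 by rewrite divr_gt0.
move=> /cvgrPdist_lt /(_ _ e2) [N _ /(_ N (leqnn N))] /=.
have rN : 0 <= rho ^+ N by rewrite exprn_ge0// ltW.
rewrite sub0r normrN ger0_norm// ltr_pdivlMr// => lt.
apply: (@lt_le_trans _ _ (p j ^+ N)); first by rewrite exprn_gt0.
by apply: (le_trans (low N)); apply: mass_mono; lra.
Qed.

Lemma fixpoint_support (R : realType) (m : nat) (rho : R)
    (p : 'I_m.+1 -> R) (mu : probability (measurableTypeR R) R)
    (hm : (0 < m)%N) (hrho : 0 < rho < 1) (hp_pos : forall j, 0 < p j)
    (hp_sum : \sum_(j < m.+1) p j = 1)
    (hmu : self_similar_measure (@ifs_map R m rho) p mu)
    (j : 'I_m.+1) (z : R) :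
  0 <= z <= 1 -> z = rho * z + j%:R * ((1 - rho) / m%:R) ->
  support_measure mu z.
Proof.
move=> z01 zE U oU Uz.
have /nbhs_ballP[e /= e0 eU] : nbhs z U by exact: open_nbhs_nbhs.
have e2 : 0 < e / 2 by rewrite divr_gt0.
have := mass_fixpoint_gt0 hm hrho hp_pos hp_sum hmu z01 zE e2.
rewrite -lte_fin /mass fineK ?mass_fin_num// => /lt_le_trans; apply.
apply: le_measure; rewrite ?inE; first exact: measurable_itv.
  exact: measurable_realfun.open_measurable.
move=> y /=; rewrite in_itv /= => /andP[y1 y2]; apply: eU.
by rewrite /ball /= ltr_norml; apply/andP; split; lra.
Qed.

(** The last hypothesis says that the pieces [[i * c, rho + i * c]] with [i != j], where
    [c = (1 - rho) / m], miss the ball of radius [rho * e] about [z]. Only the [j]-th term of the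
    self-similar sum survives, so the ball mass scales exactly by [p j]. *)
Lemma fixpoint_local_dimension (R : realType) (m : nat) (rho t : R)
    (p : 'I_m.+1 -> R) (mu : probability (measurableTypeR R) R)
    (hm : (0 < m)%N) (hrho : 0 < rho < 1) (hp_pos : forall j, 0 < p j)
    (hp_sum : \sum_(j < m.+1) p j = 1)
    (hmu : self_similar_measure (@ifs_map R m rho) p mu)
    (j : 'I_m.+1) (z : R) :
  0 <= z <= 1 -> z = rho * z + j%:R * ((1 - rho) / m%:R) -> 0 < t ->
  (forall e (i : 'I_m.+1), 0 < e <= t -> i != j ->
     z + rho * e < i%:R * ((1 - rho) / m%:R) \/
     rho + i%:R * ((1 - rho) / m%:R) < z - rho * e) ->
  has_local_dimension mu z (ln (p j) / ln rho).
Proof.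
move=> z01 zE t0 far; have /andP[r0 r1] := hrho.
apply: (@ln_ratio_cvg_self_similar R (fun e => mass mu (z - e) (z + e)) _ _ t) => //.
- exact: mass_fixpoint_gt0 zE t0.
- by move=> e; exact: mass_le1.
- by move=> a b ab; apply: mass_mono; lra.
move=> e et; rewrite (mass_ifs r0 hmu (z - _)) /= (bigD1 j)//= big1 ?addr0.
  by congr (_ * mass _ _ _); rewrite {1}zE; set d := j%:R * _; field; rewrite gt_eqF.
move=> i ij; set d := i%:R * _.
rewrite (mass_outside hm hrho hp_pos hp_sum hmu) ?mulr0//.
have [h|h] := far e i et ij; [left|right].
  by rewrite ltr_pdivrMr// mul0r subr_lt0.
by rewrite ltr_pdivlMr// mul1r ltrBrDr.
Qed.

(** The potential at [x] enters only as the constant in front of the geometric bound, which the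
    limit ignores; hence the gap [a] is the same for all interior points. *)
Lemma interior_local_dimension_le (R : realType) (m : nat) (rho eta a : R)
    (p : 'I_m.+1 -> R) (mu : probability (measurableTypeR R) R) (x l : R) :
  let c := (1 - rho) / m%:R in
  let b := c + eta * rho in
  (2 <= m)%N -> 0 < rho < 1 -> 0 < eta ->
  b <= rho * (1 - b) -> c <= rho * (1 - 2 * eta) -> 0 < a ->
  (forall j, 0 < p j) -> \sum_(j < m.+1) p j = 1 -> p ord0 = p ord_max ->
  (forall j, j != ord0 -> j != ord_max ->
     p ord0 <= p j * (eta * rho) `^ a) ->
  self_similar_measure (@ifs_map R m rho) p mu ->
  0 < x < 1 -> has_local_dimension mu x l -> l <= ln (p ord0) / ln rho - a.
Proof.
move=> c b m2 r01 e0 H1 H2 a0 p0 psum pE hp hmu x01 xl.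
have /andP[r0 r1] := r01.
have lr0 : ln rho < 0 by rewrite ln_lt0// r0.
have -> : ln (p ord0) / ln rho - a = ln (p ord0 / rho `^ a) / ln rho.
  rewrite ln_div ?posrE ?powR_gt0// ln_powR; field; exact: ltr0_neq0.
apply: (@ln_ratio_lim_le R (fun e => mass mu (x - e) (x + e)) rho _
  (end_distance b x `^ a) l r01 _ _ _ xl).
- by rewrite divr_gt0 ?powR_gt0.
- exact: powR_gt0 (end_distance_gt0 b x01).
by move=> n; exact: mass_interior_ge.
Qed.

(** * Choice of the constants and the isolated point *)

(** The bound on [rho] is the positive root of [r ^+ 2 + m * r - 1]. *)
Lemma overlap_condition (R : realType) (m rho : R) :
  0 < m -> 0 < rho -> (Num.sqrt (m ^+ 2 + 4) - m) / 2 < rho ->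
  1 < rho * (m + rho).
Proof.
move=> m0 r0; have := sqrtr_ge0 (m ^+ 2 + 4).
have : Num.sqrt (m ^+ 2 + 4) ^+ 2 = m ^+ 2 + 4.
  by rewrite sqr_sqrtr// addr_ge0 ?sqr_ge0.
set s := Num.sqrt _ => s2 s0 h.
have : s < 2 * rho + m by lra.
nra.
Qed.

Lemma exists_gain (R : realType) (m : nat) (p : 'I_m.+1 -> R) (d : R) :
  (forall j, 0 < p j) ->
  (forall j, j != ord0 -> j != ord_max -> p ord0 < p j) -> 0 < d < 1 ->
  exists2 a, 0 < a & forall j, j != ord0 -> j != ord_max ->
    p ord0 <= p j * d `^ a.
Proof.
move=> p0 hp /andP[d0 d1].
have ld : ln d < 0 by rewrite ln_lt0// d0.
pose mid := [pred j : 'I_m.+1 | (j != ord0) && (j != ord_max)].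
case: (pickP mid) => [k kP|none].
  have [i /andP[i0 im] imin] := @arg_minP _ _ _ k mid p kP.
  have gap : 0 < ln (p i / p ord0) by rewrite ln_gt0// ltr_pdivlMr// mul1r hp.
  exists (ln (p i / p ord0) / - ln d).
    by rewrite divr_gt0// oppr_gt0.
  move=> j j0 jm.
  rewrite /powR gt_eqF// invrN mulrN mulNr divfK ?ltr0_neq0//.
  rewrite expRN lnK ?posrE ?divr_gt0// invf_div mulrCA ler_pMr//.
  by rewrite ler_pdivlMr// mul1r; apply: imin; rewrite /= j0 jm.
exists 1 => // j j0 jm; have := none j; by rewrite /= j0 jm.
Qed.

Theorem corollary3p5 (R : realType) (m : nat) (rho : R) (p : 'I_m.+1 -> R)
    (mu : probability (measurableTypeR R) R)
    (hm : (2 <= m)%N)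
    (hrho : 0 < rho < 1)
    (hp_pos : forall j, 0 < p j)
    (hp_sum : \sum_(j < m.+1) p j = 1)
    (hp_sym : p ord0 = p ord_max)
    (hp_min : forall j, j != ord0 -> j != ord_max -> p ord0 < p j)
    (hmu : self_similar_measure (@ifs_map R m rho) p mu)
    (hrho_large : (Num.sqrt (m%:R ^+ 2 + 4) - m%:R) / 2 < rho) :
  exists l : R, isolated (local_dimensions mu) l.
Proof.
have /andP[r0 r1] := hrho.
have m1 := ltnW hm.
have m0 : 0 < m%:R :> R by rewrite ltr0n.
have overlap := overlap_condition m0 r0 hrho_large.
set c := (1 - rho) / m%:R.
have c0 : 0 < c by rewrite divr_gt0 ?subr_gt0.
have mc : m%:R * c = 1 - rho by rewrite mulrC divfK ?gt_eqF.
have crho : c * (1 + rho) < rho.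
  rewrite -(ltr_pM2l m0) mulrA mc; lra.
(* The two entries are the largest values of [eta] allowed by [H1] and by [H2]; both are positive by
   [crho]. *)
pose eta := Num.min ((rho - c * (1 + rho)) / (rho * (1 + rho)))
  ((rho - c) / (2 * rho)).
have eta0 : 0 < eta.
  rewrite lt_min !divr_gt0 ?mulr_gt0//; nra.
have H1 : c + eta * rho <= rho * (1 - (c + eta * rho)).
  have : eta <= (rho - c * (1 + rho)) / (rho * (1 + rho)) by rewrite ge_min lexx.
  rewrite ler_pdivlMr ?mulr_gt0//; lra.
have H2 : c <= rho * (1 - 2 * eta).
  have : eta <= (rho - c) / (2 * rho) by rewrite ge_min lexx orbT.
  rewrite ler_pdivlMr ?mulr_gt0//; lra.
have er : 0 < eta * rho < 1 by rewrite mulr_gt0//=; nra.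
have [a a0 ha] := exists_gain hp_pos hp_min er.
(* The other pieces stay at distance at least [c] from the end, so balls of radius [rho * e] with
   [e <= c / 2] meet only the extreme piece. *)
have c2 : 0 < c / 2 by rewrite divr_gt0.
pose L := ln (p ord0) / ln rho.
have dim0 : has_local_dimension mu 0 L.
  apply: (fixpoint_local_dimension m1 hrho hp_pos hp_sum hmu (j := ord0) _ _ c2).
  - by rewrite lexx ler01.
  - by rewrite mulr0 mul0r addr0.
  move=> e i /andP[e0 ec] i0; left; rewrite add0r -/c.
  have i1 : 1 <= i%:R :> R by rewrite ler1n lt0n.
  nra.
have dim1 : has_local_dimension mu 1 L.
  rewrite /L hp_sym.
  apply: (fixpoint_local_dimension m1 hrho hp_pos hp_sum hmu (j := ord_max) _ _ c2).
  - by rewrite lexx ler01.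
  - by rewrite /= -/c mc; lra.
  move=> e i /andP[e0 ec] im; right; rewrite -/c.
  have i1 : i%:R + 1 <= m%:R :> R.
    by rewrite natr1 ler_nat ltn_neqAle -ltnS ltn_ord andbT.
  nra.
have supp0 : support_measure mu 0.
  apply: (fixpoint_support m1 hrho hp_pos hp_sum hmu (j := ord0)).
    by rewrite lexx ler01.
  by rewrite mulr0 mul0r addr0.
exists L; split; first by rewrite inE; exists 0.
(* Interior points give dimensions at most [L - a], outside this open ball, so a dimension inside it
   comes from 0 or 1 and equals [L] by uniqueness of limits. *)
exists (ball L a); first exact: nbhsx_ballx.
apply/seteqP; split => [l [Ll [x sx xl]]|_ ->]; last first.
  by split; [exact: ballxx|exists 0].
have /andP[x0 x1] := support_unit_interval m1 hrho hp_pos hp_sum hmu sx.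
have uniq z : has_local_dimension mu z l -> has_local_dimension mu z L -> l = L.
  exact: cvg_unique.
have [xe|x0'] := eqVneq x 0; first by apply: (uniq 0) => //; rewrite -xe.
have [xe|x1'] := eqVneq x 1; first by apply: (uniq 1) => //; rewrite -xe.
have x01 : 0 < x < 1 by rewrite !lt_neqAle x0 x1 x1' eq_sym x0'.
have := interior_local_dimension_le hm hrho eta0 H1 H2 a0 hp_pos hp_sum hp_sym
  ha hmu x01 xl.
by move: Ll; rewrite /ball /= ltr_norml -/L => /andP[]; lra.
Qed.
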